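(* Let $t\geq 1$ and, for $1\leq i\leq t$, let $R_i$ be a non-commutative ring of finite order $n_i$ with $Z(R_i)=\{0\}$. Then $$\gamma\Big(\Gamma\Big(\prod_{i=1}^{t}R_i\Big)\Big)=\min_{1\leq i\leq t}\gamma(\Gamma(R_i)).$$
   Context: Rings are associative and are not required to have a multiplicative identity. $Z(R)$ is the center of $R$. For a non-commutative ring $R$, the commuting graph $\Gamma(R)$ is the simple graph with vertex set $R\setminus Z(R)$ in which two vertices $x,y$ are adjacent if and only if $x\neq y$ and $xy=yx$. A dominating set of a graph $G$ is a subset $D\subseteq V(G)$ such that every vertex not in $D$ is adjacent to at least one vertex of $D$; the domination number $\gamma(G)$ is the minimum cardinality of a dominating set. $\prod_{i=1}^t R_i$ is the direct product ring with componentwise operations. *)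

(* Defs.v *)
From HB Require Import structures.
From mathcomp Require Import all_boot all_order all_algebra.

Set Implicit Arguments.
Unset Strict Implicit.
Unset Printing Implicit Defensive.

Import GRing.Theory.
Local Open Scope ring_scope.

(* All ring structures of ssralg are unital, so associative rings without a
   required identity are introduced here on top of zmodType. *)
HB.mixin Record Zmodule_isRng R of GRing.Zmodule R := {
  rng_mul : R -> R -> R;
  rng_mulA : associative rng_mul;
  rng_mulDl : left_distributive rng_mul +%R;
  rng_mulDr : right_distributive rng_mul +%R
}.

#[short(type="rngType")]
HB.structure Definition Rng := {R of Zmodule_isRng R & GRing.Zmodule R}.

#[short(type="finRngType")]
HB.structure Definition FinRng := {R of Rng R & Finite R}.

Definition rng_commutative (R : rngType) : Prop := commutative (@rng_mul R).

Definition rng_center (R : finRngType) : {set R} :=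
  [set z : R | [forall x : R, rng_mul z x == rng_mul x z]].

(* finfun only provides the algebraic structures of the non-dependent
   {ffun I -> R}; the direct product needs them on {dffun forall i, R i}. *)
Section DirectProductZmodule.
Variables (I : finType) (R : I -> zmodType).
Local Notation P := {dffun forall i, R i}.

Definition dffun_zero : P := [ffun i => 0 : R i].
Definition dffun_opp (f : P) : P := [ffun i => - f i].
Definition dffun_add (f g : P) : P := [ffun i => f i + g i].

Fact dffun_addA : associative dffun_add.
Proof. by move=> f g h; apply/ffunP => i; rewrite !ffunE addrA. Qed.
Fact dffun_addC : commutative dffun_add.
Proof. by move=> f g; apply/ffunP => i; rewrite !ffunE addrC. Qed.
Fact dffun_add0 : left_id dffun_zero dffun_add.
Proof. by move=> f; apply/ffunP => i; rewrite !ffunE add0r. Qed.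
Fact dffun_addN : left_inverse dffun_zero dffun_opp dffun_add.
Proof. by move=> f; apply/ffunP => i; rewrite !ffunE addNr. Qed.

HB.instance Definition _ :=
  GRing.isZmodule.Build P dffun_addA dffun_addC dffun_add0 dffun_addN.
End DirectProductZmodule.

Section DirectProductRng.
Variables (I : finType) (R : I -> finRngType).
Local Notation P := {dffun forall i, R i}.

Definition dffun_rng_mul (f g : P) : P := [ffun i => rng_mul (f i) (g i)].

Fact dffun_rng_mulA : associative dffun_rng_mul.
Proof. by move=> f g h; apply/ffunP => i; rewrite !ffunE rng_mulA. Qed.
Fact dffun_rng_mulDl : left_distributive dffun_rng_mul +%R.
Proof. by move=> f g h; apply/ffunP => i; rewrite !ffunE rng_mulDl. Qed.
Fact dffun_rng_mulDr : right_distributive dffun_rng_mul +%R.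
Proof. by move=> f g h; apply/ffunP => i; rewrite !ffunE rng_mulDr. Qed.

HB.instance Definition _ :=
  Zmodule_isRng.Build P dffun_rng_mulA dffun_rng_mulDl dffun_rng_mulDr.

Definition rng_prod : finRngType := P.
End DirectProductRng.

Record sgraph := SGraph {
  vertex :> finType;
  adj : rel vertex;
  adj_sym : symmetric adj;
  adj_irrefl : irreflexive adj
}.

Section Domination.
Variable G : sgraph.

Definition dominating (D : {set G}) : bool :=
  [forall v, (v \notin D) ==> [exists u in D, adj v u]].

Fact dominating_setT : dominating [set: G].
Proof. by apply/forallP => v; rewrite inE. Qed.

(* [set: G] is only the witness that dominating sets exist. *)
Definition domination_number : nat :=
  #|[arg min_(D < [set: G] | dominating D) #|D|]|.

Fact domination_numberP :
  (exists2 D, dominating D & #|D| = domination_number) /\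
  (forall D, dominating D -> domination_number <= #|D|)%N.
Proof.
rewrite /domination_number; case: arg_minnP => [|D domD minD].
  exact: dominating_setT.
by split=> //; exists D.
Qed.
End Domination.

Section CommutingGraph.
Variable R : finRngType.
Implicit Types x y : {x : R | x \notin rng_center R}.

Definition commuting_adj x y : bool :=
  (x != y) && (rng_mul (val x) (val y) == rng_mul (val y) (val x)).

Fact commuting_adj_sym : symmetric commuting_adj.
Proof. by move=> x y; rewrite /commuting_adj eq_sym [rng_mul _ _ == _]eq_sym. Qed.

Fact commuting_adj_irrefl : irreflexive commuting_adj.
Proof. by move=> x; rewrite /commuting_adj eqxx. Qed.

(* The vertex type is the subtype of non-central elements; it is empty when R
   is commutative, so non-commutativity is left to the statements. *)
Definition commuting_graph : sgraph :=
  SGraph commuting_adj_sym commuting_adj_irrefl.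
End CommutingGraph.

(* Minimum of f over the nonempty index set 'I_t. Since minn has no neutral
   element on nat, the iteration starts from the value of f at index 0. *)
Definition min_ord (t : nat) (t_gt0 : (0 < t)%N) (f : 'I_t -> nat) : nat :=
  \big[minn/f (Ordinal t_gt0)]_(i < t) f i.

(* Main.v *)
Require Import Defs.
From mathcomp Require Import all_boot all_order all_algebra.

Import GRing.Theory.
Local Open Scope ring_scope.

(** Commutation in a direct product is tested one coordinate at a time, so a
    vertex of the commuting graph of the product is an element having at least
    one non-central coordinate [prod_noncentralP].

    Upper bound [domination_number_prod_le]: place a minimum dominating set
    [D] of the graph of one factor [R i] on the [i]-th axis of the product.
    Every [x] commutes with one of these elements, because only the [i]-th
    coordinate of [x] matters: if [x i] is a vertex, then [D] dominates it, and
    if [x i] is central, then any element of [D], which is not empty, will do.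

    Lower bound [domination_number_le_prod]: let [D] have fewer elements than
    any dominating set of any factor.  Then the non-central [i]-th coordinates
    of [D] do not dominate the graph of [R i], so some vertex [w i] commutes
    with none of them.  The element [w] with these coordinates commutes with no
    [d] in [D], since [d] has a non-central coordinate, and [D] does not
    dominate [w]. *)

Section CommutingDomination.
Variable R : finRngType.

Lemma noncentralP (x : R) :
  reflect (exists y, rng_mul x y != rng_mul y x) (x \notin rng_center R).
Proof. by rewrite inE negb_forall; apply: existsP. Qed.

(** A vertex commutes with itself, so membership in [D] and adjacency to a
    member of [D] merge into one commutation condition. *)
Lemma commuting_dominatingP (D : {set commuting_graph R}) :
  reflect (forall v : commuting_graph R, exists2 u : commuting_graph R,
             u \in D & rng_mul (val v) (val u) = rng_mul (val u) (val v))
          (dominating D).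
Proof.
apply: (iffP forallP) => domD v; last first.
  apply/implyP => vD; have [u uD vu] := domD v.
  apply/existsP; exists u; rewrite uD /= /commuting_adj vu eqxx andbT.
  by apply: contraNneq vD => ->.
have [vD|vD] := boolP (v \in D); first by exists v.
have /existsP[u /andP[uD /andP[_ /eqP vu]]] := implyP (domD v) vD.
by exists u.
Qed.

Lemma dominating_nonempty (D : {set commuting_graph R}) :
  ~ rng_commutative R -> dominating D -> exists u, u \in D.
Proof.
move=> ncR /commuting_dominatingP domD.
have [/forallP cR|] := boolP [forall x : R, x \in rng_center R].
  by case: ncR => x y; have := cR x; rewrite inE => /forallP/(_ y)/eqP.
by case/forallPn=> x xZ; have [u uD _] := domD (Sub x xZ); exists u.
Qed.

End CommutingDomination.

Lemma rng_mul0l (R : rngType) (x : R) : rng_mul 0 x = 0.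
Proof. by apply: (addIr (rng_mul 0 x)); rewrite -rng_mulDl !add0r. Qed.

Lemma rng_mul0r (R : rngType) (x : R) : rng_mul x 0 = 0.
Proof. by apply: (addIr (rng_mul x 0)); rewrite -rng_mulDr !add0r. Qed.

Section ProductCommutingGraph.
Variables (I : finType) (R : I -> finRngType).
Local Notation P := {dffun forall i, R i}.

Lemma prod_commP (x y : P) :
  rng_mul x y = rng_mul y x <->
  forall i, rng_mul (x i) (y i) = rng_mul (y i) (x i).
Proof.
split=> [xy i|xy]; last by apply/ffunP => i; rewrite !ffunE xy.
by have := congr1 (fun f : P => f i) xy; rewrite !ffunE.
Qed.

Definition axis (i : I) (u : R i) : P :=
  [ffun j => dfwith (fun k => 0 : R k) u j].

(** The zero coordinates of [axis i u] impose no condition on [x]. *)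
Lemma axis_comm (i : I) (u : R i) (x : P) :
  rng_mul x (axis i u) = rng_mul (axis i u) x <->
  rng_mul (x i) u = rng_mul u (x i).
Proof.
split=> [/prod_commP/(_ i)|xu]; first by rewrite ffunE dfwith_in.
apply/prod_commP => j; rewrite ffunE; case: dfwithP => [//|k _].
by rewrite rng_mul0l rng_mul0r.
Qed.

(** A non-central coordinate [x i] fails to commute with some [u], and [axis i u]
    carries this failure to the product. *)
Lemma prod_noncentralP (x : P) :
  reflect (exists i, x i \notin rng_center (R i))
          (x \notin rng_center (rng_prod R)).
Proof.
apply: (iffP (noncentralP (rng_prod R) x)) => [[y xy]|[i /noncentralP[u xu]]].
  apply/existsP; apply: contraNT xy; rewrite negb_exists => /forallP xZ.
  apply/eqP/prod_commP => i; have := xZ i.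
  by rewrite negbK inE => /forallP/(_ (y i))/eqP.
by exists (axis i u); apply: contraNneq xu => /axis_comm ->.
Qed.

Lemma axis_noncentral (i : I) (u : R i) :
  u \notin rng_center (R i) -> axis i u \notin rng_center (rng_prod R).
Proof. by move=> uZ; apply/prod_noncentralP; exists i; rewrite ffunE dfwith_in. Qed.

Definition axis_vertex (i : I) (u : commuting_graph (R i)) :
    commuting_graph (rng_prod R) :=
  Sub (axis i (val u)) (axis_noncentral i (val u) (valP u)).

Lemma domination_number_prod_le (i : I) :
  ~ rng_commutative (R i) ->
  (domination_number (commuting_graph (rng_prod R)) <=
   domination_number (commuting_graph (R i)))%N.
Proof.
move=> ncRi; have [[D domD <-] _] := domination_numberP (commuting_graph (R i)).
apply: leq_trans (leq_imset_card (axis_vertex i) D).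
apply: (domination_numberP _).2; apply/commuting_dominatingP => v.
suff [u uD vu] : exists2 u, u \in D &
    rng_mul ((val v : P) i) (val u) = rng_mul (val u) ((val v : P) i).
  by exists (axis_vertex i u); [apply: imset_f | apply/axis_comm].
(* A central coordinate commutes with everything, and [D] has some element
   because [R i] has vertices to dominate. *)
have [viZ|viZ] := boolP ((val v : P) i \in rng_center (R i)); last first.
  by have /commuting_dominatingP/(_ (Sub ((val v : P) i) viZ)) := domD.
have [u uD] := dominating_nonempty _ _ ncRi domD; exists u => //.
by move: viZ; rewrite inE => /forallP/(_ (val u))/eqP.
Qed.

(** Pulling the image back along [val] discards the central [i]-th coordinates,
    which are not vertices of the graph of [R i]. *)
Definition coord_vertices (D : {set commuting_graph (rng_prod R)}) (i : I) :
    {set commuting_graph (R i)} :=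
  [set u | val u \in [set (val d : P) i | d in D]].

Lemma card_coord_vertices D i : (#|coord_vertices D i| <= #|D|)%N.
Proof.
rewrite -(card_imset _ val_inj).
apply: leq_trans (leq_imset_card (fun d => (val d : P) i) D).
by apply/subset_leq_card/subsetP => _ /imsetP[u + ->]; rewrite inE.
Qed.

(** The bound holds because a set too small for every factor misses a vertex
    [w i] in each of them, and the misses assemble into one undominated element.
    The index set must be inhabited: the empty product is the zero ring, whose
    graph has no vertex and domination number 0. *)
Lemma domination_number_le_prod (m : nat) :
  (forall i, m <= domination_number (commuting_graph (R i)))%N -> I ->
  (m <= domination_number (commuting_graph (rng_prod R)))%N.
Proof.
move=> le_m i0.
have [[D domD <-] _] := domination_numberP (commuting_graph (rng_prod R)).
rewrite leqNgt; apply/negP => ltDm.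
(* Otherwise the coordinates of [D] would dominate the graph of [R i] with
   fewer than [m] vertices. *)
have undominated i : exists w : commuting_graph (R i),
    [forall u in coord_vertices D i,
       rng_mul (val w) (val u) != rng_mul (val u) (val w)].
  apply/existsP; apply: contraLR ltDm; rewrite negb_exists -leqNgt => /forallP dom.
  apply: leq_trans (le_m i) (leq_trans _ (card_coord_vertices D i)).
  apply: (domination_numberP _).2; apply/commuting_dominatingP => w.
  have := dom w; rewrite negb_forall => /existsP[u].
  by rewrite negb_imply negbK => /andP[uD /eqP wu]; exists u.
pose w : P := [ffun i => val (xchoose (undominated i))].
have wZ : w \notin rng_center (rng_prod R).
  by apply/prod_noncentralP; exists i0; rewrite ffunE (valP (xchoose (undominated i0))).
have /commuting_dominatingP/(_ (Sub w wZ))[d dD /prod_commP wd] := domD.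
(* The dominating [d] is a vertex, so its coordinate at some [i] is one of
   those that [w i] was chosen not to commute with. *)
have /prod_noncentralP[i diZ] := valP d.
have /forallP/(_ (Sub ((val d : P) i) diZ)) := xchooseP (undominated i).
rewrite inE SubK imset_f //=; have := wd i.
by rewrite SubK ffunE => ->; rewrite eqxx.
Qed.

End ProductCommutingGraph.

Section MinOrd.
Variables (t : nat) (t_gt0 : (0 < t)%N) (f : 'I_t -> nat).

Lemma min_ord_leq (i : 'I_t) : (min_ord t_gt0 f <= f i)%N.
Proof.
rewrite /min_ord; have := mem_index_enum i.
elim: (index_enum _) => // j r IHr; rewrite big_cons inE geq_min.
by case/predU1P=> [<-|/IHr ->]; rewrite ?leqnn ?orbT.
Qed.

Lemma leq_min_ord (m : nat) :
  (forall i, m <= f i)%N -> (m <= min_ord t_gt0 f)%N.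
Proof.
move=> le_m; apply: (big_ind (fun p => m <= p)%N) => // p q mp mq.
by rewrite leq_min mp.
Qed.

End MinOrd.

Theorem theoremC (t : nat) (t_gt0 : (0 < t)%N)
    (n : 'I_t -> nat) (R : 'I_t -> finRngType)
    (cardR : forall i, #|R i| = n i)
    (ncR : forall i, ~ rng_commutative (R i))
    (centerR : forall i, rng_center (R i) = [set 0]) :
  domination_number (commuting_graph (rng_prod R)) =
    min_ord t_gt0 (fun i => domination_number (commuting_graph (R i))).
Proof.
apply/eqP; rewrite eqn_leq; apply/andP; split.
  by apply: leq_min_ord => i; apply: domination_number_prod_le.
apply: domination_number_le_prod (Ordinal t_gt0) => i.
exact: (min_ord_leq t t_gt0 (fun i => domination_number (commuting_graph (R i)))).
Qed.
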